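(* Let $\{\alpha(n)\}_{n=2}^\infty$ be a sequence of complex numbers. (i) If, for some $D>0$, $$|\alpha(n)| \leq \frac{D}{\sqrt{n}\,\ln n}, \qquad n \geq 2,$$ then the infinite matrix $(\alpha(mn))_{m,n=2}^\infty$ defines a bounded operator on $\ell^2(\mathbb N_2)$ and $\|(\alpha(mn))_{m,n=2}^\infty\| \leq D\pi$. (ii) If, along with the hypothesis of (i) (with constant $D$), one also has that $\alpha(n)\in(0,\infty)$ for all $n\geq 2$ and $$\alpha(n) \geq \frac{C}{\sqrt{n}\,(b+\ln n)}, \qquad n\geq 2,$$ for some $b\geq 0$ and $C>0$, then $(\alpha(mn))_{m,n=2}^\infty$ is a bounded operator on $\ell^2(\mathbb N_2)$ with $$C\pi \leq \|(\alpha(mn))_{m,n=2}^\infty\| \leq D\pi.$$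
   Context: $\mathbb N_2=\{j\in\mathbb N: j\geq 2\}$, and $\ell^2(\mathbb N_2)$ is the Hilbert space of square-summable complex sequences $\{a_j\}_{j=2}^\infty$ with standard orthonormal basis $\{e_n\}_{n=2}^\infty$. A matrix $(a_{m,n})_{m,n=2}^\infty$ acts by $x=\{x_m\}\mapsto \{\sum_{m=2}^\infty a_{n,m}x_m\}_{n=2}^\infty$, and $\|\cdot\|$ is the operator norm. $\ln$ is the natural logarithm. *)

(* Defs.v *)
From Stdlib Require Import Reals.
From Coquelicot Require Import Coquelicot.
Open Scope R_scope.

(** A sequence indexed by N_2 = {2, 3, ...} is encoded as a function on [nat]
    whose values at 0 and 1 are never looked at: every sum over N_2 is written
    as a series over k : nat with index k + 2. *)

Definition in_l2 (x : nat -> C) : Prop :=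
  ex_series (fun k : nat => Cmod (x (k + 2)%nat) ^ 2).

(** Meaningful only under [in_l2 x]: [Series] is a total function. *)
Definition l2_norm (x : nat -> C) : R :=
  sqrt (Series (fun k : nat => Cmod (x (k + 2)%nat) ^ 2)).

(** [y = a x]: each series [sum_(m >= 2) a_{n,m} x_m] converges in [C], with sum [y_n]. *)
Definition mat_maps (a : nat -> nat -> C) (x y : nat -> C) : Prop :=
  forall n : nat, (2 <= n)%nat ->
    @is_series C_AbsRing C_NormedModule
      (fun k : nat => Cmult (a n (k + 2)%nat) (x (k + 2)%nat)) (y n).

Definition bounded_on_l2 (a : nat -> nat -> C) : Prop :=
  exists M : R, forall x : nat -> C, in_l2 x ->
    exists y : nat -> C,
      mat_maps a x y /\ in_l2 y /\ l2_norm y <= M * l2_norm x.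

(** The operator norm, [sup { ||a x|| : x in l^2, ||x|| <= 1 }], in [Rbar]. *)
Definition op_norm (a : nat -> nat -> C) : Rbar :=
  Lub_Rbar (fun r : R => exists x y : nat -> C,
    in_l2 x /\ l2_norm x <= 1 /\ mat_maps a x y /\ in_l2 y /\ r = l2_norm y).

Definition mult_hankel (alpha : nat -> C) : nat -> nat -> C :=
  fun m n : nat => alpha (m * n)%nat.

(* Main.v *)
Require Import Defs.
From Stdlib Require Import Reals Lra Lia.
From Coquelicot Require Import Coquelicot.
Open Scope R_scope.

(** The matrix is a multiplicative form of Hilbert's: as [ln (m n) = ln m + ln n],
    the comparison kernel is [1 / (sqrt m sqrt n (ln m + ln n))], and the
    substitution [u = ln m] turns sums over [m] with weight [1 / m] into
    integrals over [u > 0] with the kernel [1 / (u + v)], whose norm is [PI].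

    Upper bound. Schur's test ([schur_test]) with the weights
    [1 / sqrt (n ln n)] asks for
    [sum_(m >= 2) 1 / (m sqrt (ln m) (ln m + L)) <= PI / sqrt L] with
    [L = ln n]. The summand decreases in [m], so the sum is at most the integral
    from 1 to infinity, which is [PI / sqrt L] because [2 / sqrt L * atan (sqrt (u / L))]
    is a primitive in [u] ([sum_hilbert_summand_le]).

    Lower bound. With [beta = b / 2], the same weights
    [1 / sqrt (n (ln n + beta))] truncated at [N] are almost eigenvectors: if
    [ln n + beta] is larger than [ln 2 + beta] and smaller than [ln N + beta],
    each time by a factor [s ^ 2], then the [n]-th entry of the image is at least
    [c (PI - 4 / s)] times that of the vector ([hankel_test_vector_ge]). The squared
    norm of the vector is [sum 1 / (n (ln n + beta))], of the order of [ln (ln N)]: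
    it diverges, while the indices excluded by these two conditions contribute
    a bounded amount when [s] is fixed ([log_sum_pow_le]). Letting [N] and then [s] tend to
    infinity gives [c PI] ([hankel_lower_bound]). *)

(** * Comparison of sums with increments *)

(** The intermediate point is strictly inside the interval and the derivative is
    only asked for there: the primitive behind the upper bound has an infinite
    slope at the left end 1, where [ln] vanishes. *)
Lemma mvt_interior (f df : R -> R) (a b : R) :
  a < b ->
  (forall t, a < t < b -> is_derive f t (df t)) ->
  (forall t, a <= t <= b -> continuity_pt f t) ->
  exists t, a < t < b /\ f b - f a = df t * (b - a).
Proof.
  intros Hab Hd Hc.
  assert (pr1 : forall t, a < t < b -> derivable_pt f t).
  { intros t Ht; exists (df t); apply is_derive_Reals, Hd, Ht. }
  destruct (MVT f id a b pr1 (fun t _ => derivable_pt_id t) Hab Hc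
    (fun t _ => derivable_continuous_pt _ _ (derivable_pt_id t))) as [t [Ht E]].
  exists t; split; [exact Ht|].
  rewrite derive_pt_id in E.
  replace (derive_pt f t (pr1 t Ht)) with (df t) in E.
  - unfold id in E; lra.
  - symmetry; apply derive_pt_eq_0, is_derive_Reals, Hd, Ht.
Qed.

Lemma sum_n_le_telescope (u v : nat -> R) (N : nat) :
  (forall k, u k <= v (S k) - v k) -> sum_n u N <= v (S N) - v 0%nat.
Proof.
  intros H; induction N as [|N IH].
  - rewrite sum_O; apply H.
  - rewrite sum_Sn; change plus with Rplus; specialize (H (S N)); lra.
Qed.

Lemma sum_n_ge_telescope (u v : nat -> R) (N : nat) :
  (forall k, v (S k) - v k <= u k) -> v (S N) - v 0%nat <= sum_n u N.
Proof.
  intros H; induction N as [|N IH].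
  - rewrite sum_O; apply H.
  - rewrite sum_Sn; change plus with Rplus; specialize (H (S N)); lra.
Qed.

Lemma sum_n_le_ext (u v : nat -> R) (N : nat) :
  (forall k, (k <= N)%nat -> u k <= v k) -> sum_n u N <= sum_n v N.
Proof.
  induction N as [|N IH]; intros H.
  - rewrite !sum_O; apply H; lia.
  - rewrite !sum_Sn; change plus with Rplus; apply Rplus_le_compat.
    + apply IH; intros; apply H; lia.
    + apply H; lia.
Qed.

Lemma sum_n_nonneg (u : nat -> R) (N : nat) :
  (forall k, 0 <= u k) -> 0 <= sum_n u N.
Proof.
  intros H; induction N as [|N IH].
  - rewrite sum_O; apply H.
  - rewrite sum_Sn; change plus with Rplus; specialize (H (S N)); lra.
Qed.

Lemma sum_n_mono (u : nat -> R) (n m : nat) :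
  (forall k, 0 <= u k) -> (n <= m)%nat -> sum_n u n <= sum_n u m.
Proof.
  intros H; induction 1 as [|m _ IH]; [lra|].
  rewrite sum_Sn; change plus with Rplus; specialize (H (S m)); lra.
Qed.

Lemma sum_n_Rmult_l (c : R) (u : nat -> R) (N : nat) :
  sum_n (fun k => c * u k) N = c * sum_n u N.
Proof. exact (sum_n_mult_l c u N). Qed.

(** * Schur's test on sequences indexed from 2 *)

(** Cauchy-Schwarz for the splitting
    [w u = sqrt (w p) * (sqrt (w / p) u)]. *)
Lemma weighted_cauchy_schwarz (w u p : nat -> R) (N : nat) :
  (forall k, 0 <= w k) -> (forall k, 0 < p k) ->
  sum_n (fun k => w k * u k) N ^ 2 <=
  sum_n (fun k => w k * p k) N * sum_n (fun k => w k * (u k ^ 2 / p k)) N.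
Proof.
  intros Hw Hp; induction N as [|N IH].
  - rewrite !sum_O; right; field; apply Rgt_not_eq, Hp.
  - rewrite !sum_Sn; change plus with Rplus.
    set (s := sum_n (fun k => w k * u k) N) in *.
    set (a := sum_n (fun k => w k * p k) N) in *.
    set (b := sum_n (fun k => w k * (u k ^ 2 / p k)) N) in *.
    assert (Ha : 0 <= a).
    { apply sum_n_nonneg; intros k; apply Rmult_le_pos; [apply Hw|left; apply Hp]. }
    assert (Hb : 0 <= b).
    { apply sum_n_nonneg; intros k; apply Rmult_le_pos; [apply Hw|].
      apply Rdiv_le_0_compat; [apply pow2_ge_0|apply Hp]. }
    specialize (Hw (S N)); specialize (Hp (S N)).
    set (w1 := w (S N)) in *; set (u1 := u (S N)) in *; set (p1 := p (S N)) in *.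
    (* The cross terms of the product of the two enlarged sums dominate that of
       the square, by the arithmetic-geometric mean inequality. *)
    assert (Hc : 2 * s * u1 <= a * (u1 ^ 2 / p1) + b * p1).
    { assert (HX : 0 <= a * (u1 ^ 2 / p1)).
      { apply Rmult_le_pos; [exact Ha|].
        apply Rdiv_le_0_compat; [apply pow2_ge_0|exact Hp]. }
      assert (HY : 0 <= b * p1) by nra.
      assert (HXY : (a * (u1 ^ 2 / p1)) * (b * p1) = a * b * u1 ^ 2) by (field; lra).
      destruct (Rle_dec (2 * s * u1) 0) as [H0|H0]; [lra|].
      apply Rsqr_incr_0_var; [|lra]. unfold Rsqr.
      assert (Hs : s ^ 2 * u1 ^ 2 <= a * b * u1 ^ 2)
        by (apply Rmult_le_compat_r; [apply pow2_ge_0|exact IH]).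
      set (X := a * (u1 ^ 2 / p1)) in *; set (Y := b * p1) in *.
      pose proof (pow2_ge_0 (X - Y)); nra. }
    assert (E : (a + w1 * p1) * (b + w1 * (u1 ^ 2 / p1)) =
      a * b + w1 * (a * (u1 ^ 2 / p1) + b * p1) + (w1 * u1) ^ 2) by (field; lra).
    rewrite E.
    assert (w1 * (2 * s * u1) <= w1 * (a * (u1 ^ 2 / p1) + b * p1))
      by (apply Rmult_le_compat_l; assumption).
    nra.
Qed.

(** Cauchy-Schwarz in each row costs a factor [M * p n] by the row condition;
    exchanging the two sums leaves a weighted column sum for each [m], and the
    column condition gives the second factor [M] while the weights cancel.
    The bound is uniform in both truncations, so that every limit needed for
    infinite vectors can be taken afterwards. *)
Lemma schur_test_finite (B : nat -> nat -> R) (p u : nat -> R) (M : R) :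
  (forall n m, 0 <= B n m) -> (forall n, 0 < p n) ->
  (forall n N, sum_n (fun m => B n m * p m) N <= M * p n) ->
  (forall m N, sum_n (fun n => B n m * p n) N <= M * p m) ->
  forall N N',
  sum_n (fun n => sum_n (fun m => B n m * u m) N' ^ 2) N <=
  M ^ 2 * sum_n (fun m => u m ^ 2) N'.
Proof.
  intros HB Hp Hrow Hcol N N'.
  assert (Hq : forall m, 0 <= u m ^ 2 / p m).
  { intros m; apply Rdiv_le_0_compat; [apply pow2_ge_0|apply Hp]. }
  assert (HM : 0 <= M).
  { specialize (Hrow 0%nat 0%nat); rewrite sum_O in Hrow.
    specialize (HB 0%nat 0%nat); specialize (Hp 0%nat).
    assert (0 <= B 0%nat 0%nat * p 0%nat) by (apply Rmult_le_pos; lra).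
    apply Rmult_le_reg_r with (p 0%nat); lra. }
  apply Rle_trans with
    (sum_n (fun n => sum_n (fun m => M * (u m ^ 2 / p m) * (B n m * p n)) N') N).
  - apply sum_n_le_ext; intros n _.
    apply Rle_trans with (M * p n * sum_n (fun m => B n m * (u m ^ 2 / p m)) N').
    + eapply Rle_trans; [apply weighted_cauchy_schwarz with (p := p); auto|].
      apply Rmult_le_compat_r; [|apply Hrow].
      apply sum_n_nonneg; intros m; apply Rmult_le_pos; auto.
    + rewrite <- sum_n_Rmult_l; apply sum_n_le_ext; intros m _; right; ring.
  - rewrite sum_n_switch, <- sum_n_Rmult_l.
    apply sum_n_le_ext; intros m _.
    rewrite sum_n_Rmult_l.
    apply Rle_trans with (M * (u m ^ 2 / p m) * (M * p m)).
    + apply Rmult_le_compat_l; [|apply Hcol].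
      apply Rmult_le_pos; auto.
    + right; field; apply Rgt_not_eq, Hp.
Qed.

Lemma is_lim_seq_sum_n (f : nat -> nat -> R) (l : nat -> R) (N : nat) :
  (forall k, is_lim_seq (f k) (l k)) ->
  is_lim_seq (fun j => sum_n (fun k => f k j) N) (sum_n l N).
Proof.
  intros H; induction N as [|N IH].
  - apply is_lim_seq_ext with (f 0%nat); [intros; now rewrite sum_O|].
    rewrite sum_O; apply H.
  - apply is_lim_seq_ext with (fun j => sum_n (fun k => f k j) N + f (S N) j).
    + intros j; now rewrite sum_Sn.
    + rewrite sum_Sn; exact (is_lim_seq_plus' _ _ _ _ IH (H (S N))).
Qed.

Lemma nonneg_series_bounded (a : nat -> R) (M : R) :
  (forall k, 0 <= a k) -> (forall N, sum_n a N <= M) ->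
  ex_series a /\ Series a <= M.
Proof.
  intros Ha HM.
  destruct (ex_finite_lim_seq_incr (sum_n a) M) as [l Hl]; [|exact HM|].
  - intros n; apply sum_n_mono; [exact Ha|lia].
  - assert (Hs : is_series a l) by exact Hl.
    split; [exists l; exact Hs|].
    rewrite (is_series_unique _ _ Hs).
    exact (is_lim_seq_le _ _ _ (Finite M) HM Hl (is_lim_seq_const M)).
Qed.

Lemma sum_n_le_Series (a : nat -> R) (N : nat) :
  (forall k, 0 <= a k) -> ex_series a -> sum_n a N <= Series a.
Proof.
  intros Ha Hs.
  apply Series_correct in Hs.
  apply (is_lim_seq_incr_compare (sum_n a)); [exact Hs|].
  intros n; apply sum_n_mono; [exact Ha|lia].
Qed.

Lemma is_series_Re (a : nat -> C) (l : C) :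
  @is_series C_AbsRing C_NormedModule a l -> is_series (fun k => Re (a k)) (Re l).
Proof.
  intros H.
  assert (E : forall n, Re (sum_n a n) = sum_n (fun k => Re (a k)) n).
  { induction n as [|n IH]; [now rewrite !sum_O|now rewrite !sum_Sn, <- IH]. }
  eapply filterlim_ext; [exact E|].
  exact (filterlim_comp _ _ _ _ _ _ _ _ H (continuous_fst (fst l) (snd l))).
Qed.

Lemma is_series_Im (a : nat -> C) (l : C) :
  @is_series C_AbsRing C_NormedModule a l -> is_series (fun k => Im (a k)) (Im l).
Proof.
  intros H.
  assert (E : forall n, Im (sum_n a n) = sum_n (fun k => Im (a k)) n).
  { induction n as [|n IH]; [now rewrite !sum_O|now rewrite !sum_Sn, <- IH]. }
  eapply filterlim_ext; [exact E|].
  exact (filterlim_comp _ _ _ _ _ _ _ _ H (continuous_snd (fst l) (snd l))).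
Qed.

Lemma Cmod_is_series_le (a : nat -> C) (l : C) :
  @is_series C_AbsRing C_NormedModule a l ->
  ex_series (fun k => Cmod (a k)) ->
  Cmod l <= Series (fun k => Cmod (a k)).
Proof.
  intros H Hex.
  assert (Hn : is_lim_seq (fun n => Cmod (sum_n a n)) (Cmod l)).
  { exact (filterlim_comp _ _ _ _ _ _ _ _ H
      (@filterlim_norm C_AbsRing C_NormedModule l)). }
  refine (is_lim_seq_le _ _ (Finite _) (Finite _) _ Hn (Series_correct _ Hex)).
  intros n; exact (@norm_sum_n_m C_AbsRing C_NormedModule a 0 n).
Qed.

(** The uniform bound on truncations first shows that every row converges
    absolutely on [x], which gives the image vector, and then, by letting the
    column truncation and the row truncation tend to infinity in this order,
    bounds the norm of that vector. The estimate is stated for every image [y],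
    as the operator norm ranges over all of them. *)
Lemma schur_test (a : nat -> nat -> C) (p : nat -> R) (M : R) :
  (forall n, 0 < p n) ->
  (forall n N, sum_n (fun m => Cmod (a (n + 2)%nat (m + 2)%nat) * p m) N <= M * p n) ->
  (forall m N, sum_n (fun n => Cmod (a (n + 2)%nat (m + 2)%nat) * p n) N <= M * p m) ->
  forall x, in_l2 x ->
  (exists y, mat_maps a x y) /\
  (forall y, mat_maps a x y -> in_l2 y /\ l2_norm y <= M * l2_norm x).
Proof.
  intros Hp Hrow Hcol x Hx.
  set (B := fun n m => Cmod (a (n + 2)%nat (m + 2)%nat)).
  set (u := fun m => Cmod (x (m + 2)%nat)).
  assert (HB : forall n m, 0 <= B n m) by (intros; apply Cmod_ge_0).
  assert (Hu : forall m, 0 <= u m) by (intros; apply Cmod_ge_0).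
  assert (HM : 0 <= M).
  { specialize (Hrow 0%nat 0%nat); rewrite sum_O in Hrow.
    specialize (HB 0%nat 0%nat); specialize (Hp 0%nat).
    assert (0 <= B 0%nat 0%nat * p 0%nat) by (apply Rmult_le_pos; lra).
    apply Rmult_le_reg_r with (p 0%nat); unfold B in *; lra. }
  set (s := Series (fun m => u m ^ 2)).
  assert (Hs : 0 <= s).
  { eapply Rle_trans; [|apply (sum_n_le_Series _ 0); [|exact Hx]].
    - apply sum_n_nonneg; intros; apply pow2_ge_0.
    - intros; apply pow2_ge_0. }
  assert (Hfin : forall N N',
    sum_n (fun n => sum_n (fun m => B n m * u m) N' ^ 2) N <= M ^ 2 * s).
  { intros N N'.
    eapply Rle_trans; [apply (schur_test_finite B p u M); auto|].
    apply Rmult_le_compat_l; [apply pow2_ge_0|].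
    apply sum_n_le_Series; [intros; apply pow2_ge_0|exact Hx]. }
  assert (Hpos : forall n k, 0 <= B n k * u k)
    by (intros; apply Rmult_le_pos; auto).
  assert (Habs : forall n, ex_series (fun m => B n m * u m)).
  { intros n.
    refine (proj1 (nonneg_series_bounded _ (sqrt (M ^ 2 * s)) (Hpos n) _)); intros N'.
    rewrite <- (sqrt_pow2 (sum_n _ N')) by (apply sum_n_nonneg; auto).
    apply sqrt_le_1_alt.
    eapply Rle_trans; [|apply (Hfin n N')].
    (* A single row is one of the nonnegative terms of the sum over rows. *)
    destruct n as [|n]; [rewrite sum_O; lra|].
    rewrite sum_Sn; change plus with Rplus.
    match goal with |- _ <= ?z + _ => assert (0 <= z) end; [|lra].
    apply sum_n_nonneg; intros; apply pow2_ge_0. }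
  set (Y := fun n => Series (fun m => B n m * u m)).
  assert (HY : forall N, sum_n (fun n => Y n ^ 2) N <= M ^ 2 * s).
  { intros N.
    refine (is_lim_seq_le _ _ (Finite _) (Finite _) (fun j => Hfin N j) _
      (is_lim_seq_const _)).
    apply (is_lim_seq_sum_n (fun n j => sum_n (fun m => B n m * u m) j ^ 2)).
    intros n; pose proof (Series_correct _ (Habs n)) as Hl.
    assert (Hl' : is_lim_seq (sum_n (fun m => B n m * u m)) (Y n)) by exact Hl.
    simpl. apply is_lim_seq_mult'; [exact Hl'|].
    apply is_lim_seq_mult'; [exact Hl'|apply is_lim_seq_const]. }
  assert (Hmod : forall n k,
    Cmod (Cmult (a (n + 2)%nat (k + 2)%nat) (x (k + 2)%nat)) = B n k * u k)
    by (intros; apply Cmod_mult).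
  split.
  - exists (fun n => (Series (fun k => Re (Cmult (a n (k + 2)%nat) (x (k + 2)%nat))),
                      Series (fun k => Im (Cmult (a n (k + 2)%nat) (x (k + 2)%nat))))).
    intros n Hn.
    destruct (@ex_series_le C_AbsRing C_CompleteNormedModule
      (fun k => Cmult (a n (k + 2)%nat) (x (k + 2)%nat))
      (fun k => B (n - 2)%nat k * u k)) as [l Hl].
    + intros k; rewrite <- Hmod; replace (n - 2 + 2)%nat with n by lia.
      apply Rle_refl.
    + apply Habs.
    + rewrite (is_series_unique _ _ (is_series_Re _ _ Hl)).
      rewrite (is_series_unique _ _ (is_series_Im _ _ Hl)).
      destruct l; exact Hl.
  - intros y Hy.
    assert (Hle : forall n, Cmod (y (n + 2)%nat) <= Y n).
    { intros n.
      assert (E : Y n =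
        Series (fun k => Cmod (Cmult (a (n + 2)%nat (k + 2)%nat) (x (k + 2)%nat)))).
      { apply Series_ext; intros; symmetry; apply Hmod. }
      rewrite E; apply Cmod_is_series_le; [apply Hy; lia|].
      apply ex_series_ext with (2 := Habs n); intros; symmetry; apply Hmod. }
    destruct (nonneg_series_bounded (fun n => Cmod (y (n + 2)%nat) ^ 2) (M ^ 2 * s))
      as [Hex Hb].
    + intros; apply pow2_ge_0.
    + intros N; eapply Rle_trans; [|apply HY].
      apply sum_n_le_ext; intros; apply pow_incr; split; [apply Cmod_ge_0|apply Hle].
    + split; [exact Hex|].
      unfold l2_norm; fold u.
      rewrite <- (sqrt_pow2 M) by exact HM.
      rewrite <- sqrt_mult; [|apply pow2_ge_0|exact Hs].
      now apply sqrt_le_1_alt.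
Qed.

(** * The integral behind the constant pi *)

Lemma ln_nonneg (t : R) : 1 <= t -> 0 <= ln t.
Proof. intros H; rewrite <- ln_1; apply ln_le; lra. Qed.

Lemma ln_pos (t : R) : 1 < t -> 0 < ln t.
Proof. intros H; rewrite <- ln_1; apply ln_increasing; lra. Qed.

(** With [u = ln t + beta] and [dt / t = du], this is the Hilbert integrand
    [1 / (sqrt u * (u + L))]. *)
Definition hilbert_summand (beta L t : R) : R :=
  / (t * sqrt (ln t + beta) * (ln t + beta + L)).

(** The primitive of [1 / (sqrt u * (u + L))] at [u = ln t + beta]. For
    [beta = 0] it grows from 0 at [t = 1] to [PI / sqrt L] at infinity. *)
Definition hilbert_primitive (beta L t : R) : R :=
  2 / sqrt L * atan (sqrt (ln t + beta) / sqrt L).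

Lemma is_derive_hilbert_primitive (beta L t : R) :
  0 < L -> 0 < t -> 0 < ln t + beta ->
  is_derive (hilbert_primitive beta L) t (hilbert_summand beta L t).
Proof.
  intros HL Ht Hu; unfold hilbert_primitive, hilbert_summand.
  pose proof (sqrt_lt_R0 _ HL) as HsL; pose proof (sqrt_lt_R0 _ Hu) as Hsu.
  auto_derive; [repeat split; lra|].
  assert (EL : L = sqrt L * sqrt L) by (symmetry; apply sqrt_sqrt; lra).
  assert (Eu : ln t + beta = sqrt (ln t + beta) * sqrt (ln t + beta))
    by (symmetry; apply sqrt_sqrt; lra).
  set (r := sqrt L) in *; set (v := sqrt (ln t + beta)) in *.
  rewrite EL, Eu.
  assert (0 < r * r) by nra; assert (0 < v * v) by nra.
  field; repeat split; try lra; apply Rgt_not_eq; nra.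
Qed.

Lemma continuity_hilbert_primitive (beta L t : R) :
  0 < L -> 0 < t -> 0 <= ln t + beta ->
  continuity_pt (hilbert_primitive beta L) t.
Proof.
  intros HL Ht Hu; unfold hilbert_primitive.
  apply continuity_pt_filterlim.
  apply (continuous_comp (fun t => sqrt (ln t + beta) / sqrt L)
           (fun v => 2 / sqrt L * atan v)).
  - apply (continuous_mult (fun t => sqrt (ln t + beta)) (fun _ => / sqrt L));
      [|apply continuous_const].
    apply (continuous_comp (fun t => ln t + beta) sqrt).
    + apply (continuous_plus ln (fun _ => beta)); [|apply continuous_const].
      apply (ex_derive_continuous ln); exists (/ t); now apply is_derive_ln.
    + apply continuity_pt_filterlim, continuity_pt_sqrt, Hu.
  - apply (continuous_mult (fun _ => 2 / sqrt L) atan); [apply continuous_const|].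
    apply (ex_derive_continuous atan); eexists; apply is_derive_atan.
Qed.

Lemma hilbert_summand_antitone (beta L s t : R) :
  0 < L -> 0 < s <= t -> 0 < ln s + beta ->
  hilbert_summand beta L t <= hilbert_summand beta L s.
Proof.
  intros HL Hst Hs; unfold hilbert_summand.
  assert (Hln : ln s <= ln t) by (apply ln_le; lra).
  pose proof (sqrt_lt_R0 _ Hs) as Hr.
  assert (Hsq : sqrt (ln s + beta) <= sqrt (ln t + beta)) by (apply sqrt_le_1_alt; lra).
  apply Rinv_le_contravar.
  - repeat apply Rmult_lt_0_compat; lra.
  - apply Rmult_le_compat; [|lra| |lra].
    + apply Rmult_le_pos; lra.
    + apply Rmult_le_compat; lra.
Qed.

Lemma hilbert_summand_le_primitive (L t : R) :
  0 < L -> 1 <= t ->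
  hilbert_summand 0 L (t + 1) <= hilbert_primitive 0 L (t + 1) - hilbert_primitive 0 L t.
Proof.
  intros HL Ht.
  destruct (mvt_interior (hilbert_primitive 0 L) (hilbert_summand 0 L) t (t + 1))
    as [s [Hs E]]; [lra| | |].
  - intros s Hs; apply is_derive_hilbert_primitive; [lra|lra|].
    pose proof (ln_pos s); lra.
  - intros s Hs; apply continuity_hilbert_primitive; [lra|lra|].
    pose proof (ln_nonneg s); lra.
  - rewrite E; replace (t + 1 - t) with 1 by ring; rewrite Rmult_1_r.
    apply hilbert_summand_antitone; [lra|lra|]. pose proof (ln_pos s); lra.
Qed.

Lemma hilbert_primitive_le_summand (beta L t : R) :
  0 <= beta -> 0 < L -> 1 < t ->
  hilbert_primitive beta L (t + 1) - hilbert_primitive beta L t <= hilbert_summand beta L t.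
Proof.
  intros Hb HL Ht.
  destruct (mvt_interior (hilbert_primitive beta L) (hilbert_summand beta L) t (t + 1))
    as [s [Hs E]]; [lra| | |].
  - intros s Hs; apply is_derive_hilbert_primitive; [lra|lra|].
    pose proof (ln_pos s); lra.
  - intros s Hs; apply continuity_hilbert_primitive; [lra|lra|].
    pose proof (ln_nonneg s); lra.
  - rewrite E; replace (t + 1 - t) with 1 by ring; rewrite Rmult_1_r.
    apply hilbert_summand_antitone; [lra|lra|]. pose proof (ln_pos t); lra.
Qed.

Lemma INR_add2 (k : nat) : INR (k + 2) = INR (S k) + 1.
Proof. replace (k + 2)%nat with (S (S k)) by lia; apply S_INR. Qed.

Lemma INR_add2_ge (k : nat) : 2 <= INR (k + 2).
Proof. rewrite plus_INR; simpl; pose proof (pos_INR k); lra. Qed.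

Lemma ln_add2_pos (k : nat) : 0 < ln (INR (k + 2)).
Proof. pose proof (INR_add2_ge k); apply ln_pos; lra. Qed.

(** The sum from 2 is at most the integral from 1, and the integral over
    all [t >= 1] is [PI / sqrt L]. Starting the integral at 1, where the
    summand is singular but integrable, is what makes the constant exact. *)
Lemma sum_hilbert_summand_le (L : R) (N : nat) :
  0 < L -> sum_n (fun k => hilbert_summand 0 L (INR (k + 2))) N <= PI / sqrt L.
Proof.
  intros HL.
  eapply Rle_trans.
  - apply (sum_n_le_telescope _ (fun k => hilbert_primitive 0 L (INR (S k)))).
    intros k; rewrite INR_add2, (S_INR (S k)).
    apply hilbert_summand_le_primitive; [exact HL|].
    rewrite S_INR; pose proof (pos_INR k); lra.
  - unfold hilbert_primitive at 2; simpl INR.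
    replace (ln 1 + 0) with 0 by (rewrite ln_1; ring).
    rewrite sqrt_0; replace (0 / sqrt L) with 0 by (unfold Rdiv; ring); rewrite atan_0.
    unfold hilbert_primitive.
    match goal with |- context [atan ?z] => pose proof (atan_bound z) as [_ H] end.
    pose proof (sqrt_lt_R0 _ HL) as HsL.
    replace (PI / sqrt L) with (2 / sqrt L * (PI / 2)) by (field; lra).
    assert (0 < 2 / sqrt L) by (apply Rdiv_lt_0_compat; lra).
    rewrite Rmult_0_r, Rminus_0_r; apply Rmult_le_compat_l; lra.
Qed.

(** * The divergent sums that give the squared norms of the test vectors *)

Definition log_sum (beta : R) (N : nat) : R :=
  sum_n (fun k => / (INR (k + 2) * (ln (INR (k + 2)) + beta))) N.

Lemma lnln_increment (beta t : R) :
  0 <= beta -> 1 < t ->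
  / ((t + 1) * (ln (t + 1) + beta)) <= ln (ln (t + 1) + beta) - ln (ln t + beta)
    <= / (t * (ln t + beta)).
Proof.
  intros Hb Ht.
  assert (Hd : forall s, 1 < s ->
    is_derive (fun s => ln (ln s + beta)) s (/ (s * (ln s + beta)))).
  { intros s Hs; pose proof (ln_pos s Hs).
    auto_derive; [repeat split; lra|field; split; lra]. }
  destruct (mvt_interior (fun s => ln (ln s + beta)) (fun s => / (s * (ln s + beta)))
    t (t + 1)) as [s [Hs E]]; [lra| | |].
  - intros s Hs; apply Hd; lra.
  - intros s Hs; apply continuity_pt_filterlim.
    apply (ex_derive_continuous (fun s => ln (ln s + beta))).
    eexists; apply Hd; lra.
  - replace (t + 1 - t) with 1 in E by ring; rewrite Rmult_1_r in E; rewrite E.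
    pose proof (ln_pos t Ht).
    assert (ln t <= ln s) by (apply ln_le; lra).
    assert (ln s <= ln (t + 1)) by (apply ln_le; lra).
    split; apply Rinv_le_contravar; try (apply Rmult_lt_0_compat; lra);
      apply Rmult_le_compat; lra.
Qed.

Lemma log_sum_increment_le (beta : R) (n m : nat) :
  0 <= beta -> (n <= m)%nat ->
  log_sum beta m - log_sum beta n <=
  ln (ln (INR (m + 2)) + beta) - ln (ln (INR (n + 2)) + beta).
Proof.
  intros Hb; induction 1 as [|m _ IH]; [lra|].
  unfold log_sum in *; rewrite sum_Sn; change plus with Rplus.
  pose proof (INR_add2_ge m) as Hm.
  destruct (lnln_increment beta (INR (m + 2))) as [H _]; [exact Hb|lra|].
  replace (S m + 2)%nat with (S (m + 2)) by lia; rewrite S_INR; lra.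
Qed.

Lemma is_lim_seq_ln_add2 : is_lim_seq (fun n => ln (INR (n + 2))) p_infty.
Proof.
  apply (filterlim_comp _ _ _ (fun n => INR (n + 2)) ln _ (Rbar_locally p_infty)).
  - apply (is_lim_seq_incr_n INR 2 p_infty), is_lim_seq_INR.
  - exact is_lim_ln_p.
Qed.

(** The comparison with the primitive [ln (ln t + beta)], which tends to
    infinity. *)
Lemma is_lim_seq_log_sum (beta : R) :
  0 <= beta -> is_lim_seq (log_sum beta) p_infty.
Proof.
  intros Hb.
  apply is_lim_seq_le_p_loc with
    (fun n => ln (ln (INR (S n + 2)) + beta) - ln (ln (INR (0 + 2)) + beta)).
  - exists 0%nat; intros N _; unfold log_sum.
    apply (sum_n_ge_telescope _ (fun k => ln (ln (INR (k + 2)) + beta))).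
    intros k; pose proof (INR_add2_ge k).
    replace (S k + 2)%nat with (S (k + 2)) by lia; rewrite S_INR.
    apply lnln_increment; [exact Hb|lra].
  - apply is_lim_seq_minus with p_infty (ln (ln (INR (0 + 2)) + beta));
      [|apply is_lim_seq_const|reflexivity].
    apply (is_lim_seq_incr_1 (fun n => ln (ln (INR (n + 2)) + beta))).
    apply (filterlim_comp _ _ _ (fun n => ln (INR (n + 2)) + beta) ln _
      (Rbar_locally p_infty)); [|exact is_lim_ln_p].
    apply is_lim_seq_plus with p_infty beta;
      [exact is_lim_seq_ln_add2|apply is_lim_seq_const|reflexivity].
Qed.

Lemma atan_le (x : R) : 0 <= x -> atan x <= x.
Proof.
  intros [Hx| <-]; [|rewrite atan_0; lra].
  destruct (mvt_interior atan (fun t => / (1 + t ^ 2)) 0 x) as [t [Ht E]]; [lra| | |].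
  - intros t _; apply is_derive_Reals.
    replace (t ^ 2) with (t²) by (unfold Rsqr; ring). apply is_derive_Reals, is_derive_atan.
  - intros t _; apply continuity_pt_filterlim, (ex_derive_continuous atan).
    eexists; apply is_derive_atan.
  - rewrite atan_0, !Rminus_0_r in E; rewrite E.
    assert (/ (1 + t ^ 2) <= 1) by (rewrite <- Rinv_1; apply Rinv_le_contravar; nra).
    nra.
Qed.

(** * The upper bound *)

(** The multiplicative form of the weight [u ^ (-1/2)] that is extremal in
    Schur's test for the kernel [1 / (u + v)]. *)
Definition hilbert_weight (k : nat) : R :=
  / (sqrt (INR (k + 2)) * sqrt (ln (INR (k + 2)))).

Lemma ln_mul_add2 (n m : nat) :
  ln (INR ((n + 2) * (m + 2))) = ln (INR (n + 2)) + ln (INR (m + 2)).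
Proof.
  pose proof (INR_add2_ge n); pose proof (INR_add2_ge m).
  rewrite mult_INR; apply ln_mult; lra.
Qed.

Lemma sqrt_mul_add2 (n m : nat) :
  sqrt (INR ((n + 2) * (m + 2))) = sqrt (INR (n + 2)) * sqrt (INR (m + 2)).
Proof. rewrite mult_INR; apply sqrt_mult_alt, pos_INR. Qed.

(** Since [ln (n m) = ln n + ln m], the row of [n] applied to the weights
    is a sum of Hilbert summands with [L = ln n]. *)
Lemma hankel_row_weight_le (alpha : nat -> C) (D : R) :
  0 < D ->
  (forall n, (2 <= n)%nat -> Cmod (alpha n) <= D / (sqrt (INR n) * ln (INR n))) ->
  forall n N,
  sum_n (fun m => Cmod (alpha ((n + 2) * (m + 2))%nat) * hilbert_weight m) N
    <= D * PI * hilbert_weight n.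
Proof.
  intros HD Ha n N.
  pose proof (INR_add2_ge n) as Hn; pose proof (ln_add2_pos n) as Ln.
  assert (Sn : 0 < sqrt (INR (n + 2))) by (apply sqrt_lt_R0; lra).
  pose proof (sqrt_lt_R0 _ Ln) as SLn.
  apply Rle_trans with (sum_n (fun m => D / sqrt (INR (n + 2)) *
    hilbert_summand 0 (ln (INR (n + 2))) (INR (m + 2))) N).
  - apply sum_n_le_ext; intros m _.
    pose proof (INR_add2_ge m) as Hm; pose proof (ln_add2_pos m) as Lm.
    assert (Sm : 0 < sqrt (INR (m + 2))) by (apply sqrt_lt_R0; lra).
    pose proof (sqrt_lt_R0 _ Lm) as SLm.
    unfold hilbert_weight, hilbert_summand; rewrite Rplus_0_r.
    eapply Rle_trans.
    + apply Rmult_le_compat_r; [left; apply Rinv_0_lt_compat, Rmult_lt_0_compat; lra|].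
      apply Ha; lia.
    + rewrite ln_mul_add2, sqrt_mul_add2; right.
      assert (Em := sqrt_sqrt (INR (m + 2)) ltac:(lra)).
      set (q := sqrt (INR (m + 2))) in *; set (l := ln (INR (m + 2))) in *.
      rewrite <- Em; field; repeat split; lra.
  - rewrite sum_n_Rmult_l; unfold hilbert_weight.
    apply Rle_trans with (D / sqrt (INR (n + 2)) * (PI / sqrt (ln (INR (n + 2))))).
    + apply Rmult_le_compat_l; [left; apply Rdiv_lt_0_compat; lra|].
      apply sum_hilbert_summand_le, Ln.
    + right; field; lra.
Qed.

Lemma hankel_schur (alpha : nat -> C) (D : R) :
  0 < D ->
  (forall n, (2 <= n)%nat -> Cmod (alpha n) <= D / (sqrt (INR n) * ln (INR n))) ->
  forall x, in_l2 x ->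
  (exists y, mat_maps (mult_hankel alpha) x y) /\
  (forall y, mat_maps (mult_hankel alpha) x y ->
     in_l2 y /\ l2_norm y <= D * PI * l2_norm x).
Proof.
  intros HD Ha; apply schur_test with (p := hilbert_weight).
  - intros n; apply Rinv_0_lt_compat, Rmult_lt_0_compat; apply sqrt_lt_R0.
    + pose proof (INR_add2_ge n); lra.
    + apply ln_add2_pos.
  - exact (hankel_row_weight_le alpha D HD Ha).
  - intros m N; eapply Rle_trans; [|apply (hankel_row_weight_le alpha D HD Ha m N)].
    apply sum_n_le_ext; intros n _; unfold mult_hankel.
    rewrite Nat.mul_comm; apply Rle_refl.
Qed.

(** * The lower bound *)

Lemma is_series_finite_support (a : nat -> R) (N : nat) :
  (forall k, (N < k)%nat -> a k = 0) -> is_series a (sum_n a N).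
Proof.
  intros H; change (is_lim_seq (sum_n a) (sum_n a N)).
  apply (is_lim_seq_ext_loc (fun _ => sum_n a N)); [|apply is_lim_seq_const].
  exists N; induction 1 as [|m Hm IH]; [reflexivity|].
  rewrite sum_Sn, <- IH, H by lia; symmetry; apply Rplus_0_r.
Qed.

Lemma sum_n_increment_le (u v : nat -> R) (n m : nat) :
  (n <= m)%nat -> (forall k, (n < k <= m)%nat -> u k <= v k) ->
  sum_n u m - sum_n u n <= sum_n v m - sum_n v n.
Proof.
  induction 1 as [|m Hm IH]; intros H; [lra|].
  rewrite !sum_Sn; change plus with Rplus.
  assert (u (S m) <= v (S m)) by (apply H; lia).
  assert (sum_n u m - sum_n u n <= sum_n v m - sum_n v n) by (apply IH; intros; apply H; lia).
  lra.
Qed.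

(** The truncation at [N + 2] of the weight [1 / sqrt (n (ln n + beta))], which
    barely fails to be square-summable; [r] normalises it. *)
Definition test_vector (beta r : R) (N n : nat) : C :=
  if (n <=? N + 2)%nat
  then RtoC (r / (sqrt (INR n) * sqrt (ln (INR n) + beta))) else RtoC 0.

Lemma test_vector_in (beta r : R) (N k : nat) :
  (k <= N)%nat ->
  test_vector beta r N (k + 2) =
  RtoC (r / (sqrt (INR (k + 2)) * sqrt (ln (INR (k + 2)) + beta))).
Proof.
  intros H; unfold test_vector.
  now replace (k + 2 <=? N + 2)%nat with true by (symmetry; apply Nat.leb_le; lia).
Qed.

Lemma test_vector_out (beta r : R) (N k : nat) :
  (N < k)%nat -> test_vector beta r N (k + 2) = RtoC 0.
Proof.
  intros H; unfold test_vector.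
  now replace (k + 2 <=? N + 2)%nat with false by (symmetry; apply Nat.leb_gt; lia).
Qed.

Lemma test_vector_sq_norm (beta r : R) (N : nat) :
  0 <= beta ->
  is_series (fun k => Cmod (test_vector beta r N (k + 2)) ^ 2) (r ^ 2 * log_sum beta N).
Proof.
  intros Hb.
  replace (r ^ 2 * log_sum beta N) with
    (sum_n (fun k => Cmod (test_vector beta r N (k + 2)) ^ 2) N).
  - apply is_series_finite_support; intros k Hk.
    rewrite test_vector_out, Cmod_0 by exact Hk; ring.
  - unfold log_sum; rewrite <- sum_n_Rmult_l; apply sum_n_ext_loc; intros k Hk.
    rewrite test_vector_in, Cmod_R, pow2_abs by exact Hk.
    pose proof (INR_add2_ge k); pose proof (ln_add2_pos k).
    unfold Rdiv; rewrite Rpow_mult_distr, pow_inv, Rpow_mult_distr, !pow2_sqrt by lra.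
    reflexivity.
Qed.

(** When [L] is far, on the multiplicative scale, from both ends [ln 2 + beta] and
    [ln t + beta], the integral between them is close to its full value
    [PI / sqrt L]: the arctangents are at least [atan s = PI/2 - atan (1/s)]
    and at most [atan (1/s)], and [atan (1/s) <= 1/s]. *)
Lemma hilbert_primitive_gap (beta L s t : R) :
  0 <= beta -> 0 < L -> 0 < s ->
  s ^ 2 * (ln 2 + beta) <= L -> s ^ 2 * L <= ln t + beta ->
  (PI - 4 / s) / sqrt L <= hilbert_primitive beta L t - hilbert_primitive beta L 2.
Proof.
  intros Hb HL Hs H2 Ht; unfold hilbert_primitive.
  pose proof (sqrt_lt_R0 _ HL) as HsL.
  assert (Hp : 0 < s ^ 2) by (apply pow_lt; lra).
  assert (Hln : 0 < ln 2) by (apply ln_pos; lra).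
  assert (Hhi : s <= sqrt (ln t + beta) / sqrt L).
  { apply Rle_div_r; [exact HsL|].
    rewrite <- (sqrt_pow2 s) at 1 by lra.
    rewrite <- sqrt_mult_alt by lra; apply sqrt_le_1_alt, Ht. }
  assert (Hlo : sqrt (ln 2 + beta) / sqrt L <= / s).
  { apply Rle_div_l; [exact HsL|].
    apply Rmult_le_reg_l with s; [exact Hs|].
    rewrite <- Rmult_assoc, Rinv_r, Rmult_1_l by lra.
    rewrite <- (sqrt_pow2 s) at 1 by lra.
    rewrite <- sqrt_mult_alt by lra; apply sqrt_le_1_alt, H2. }
  assert (Hmono : forall u v, u <= v -> atan u <= atan v).
  { intros u v [H| ->]; [left; now apply atan_increasing|apply Rle_refl]. }
  apply Hmono in Hhi; apply Hmono in Hlo.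
  pose proof (atan_inv s Hs) as Hi.
  assert (Hsi : 0 <= / s) by (left; apply Rinv_0_lt_compat, Hs).
  pose proof (atan_le (/ s) Hsi) as Hle.
  replace ((PI - 4 / s) / sqrt L) with (2 / sqrt L * (PI / 2 - 2 * / s)) by (field; lra).
  rewrite <- Rmult_minus_distr_l.
  apply Rmult_le_compat_l; [left; apply Rdiv_lt_0_compat; lra|lra].
Qed.

(** In the middle range of indices the image of the test vector is at least
    [c * (PI - 4 / s)] times the vector itself. The shift is [b / 2] because
    [b + ln m + ln n] is then the sum of the two shifted logarithms. *)
Lemma hankel_test_vector_ge (alpha : nat -> C) (b c r s : R) (N k : nat) (y : nat -> C) :
  0 <= b -> 0 < c -> 0 <= r -> 0 < s ->
  (forall n, (2 <= n)%nat -> c / (sqrt (INR n) * (b + ln (INR n))) <= Re (alpha n)) ->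
  mat_maps (mult_hankel alpha) (test_vector (b / 2) r N) y ->
  s ^ 2 * (ln 2 + b / 2) <= ln (INR (k + 2)) + b / 2 ->
  s ^ 2 * (ln (INR (k + 2)) + b / 2) <= ln (INR (N + 3)) + b / 2 ->
  c * r * (PI - 4 / s) / (sqrt (INR (k + 2)) * sqrt (ln (INR (k + 2)) + b / 2))
    <= Cmod (y (k + 2)%nat).
Proof.
  intros Hb Hc Hr Hs Ha Hy Hlo Hhi.
  set (L := ln (INR (k + 2)) + b / 2) in *.
  pose proof (INR_add2_ge k) as Hk; pose proof (ln_add2_pos k) as Lk.
  assert (HL : 0 < L) by (unfold L; lra).
  assert (Sk : 0 < sqrt (INR (k + 2))) by (apply sqrt_lt_R0; lra).
  pose proof (sqrt_lt_R0 _ HL) as SL.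
  apply Rle_trans with (Re (y (k + 2)%nat));
    [|eapply Rle_trans; [apply Rle_abs|apply re_le_Cmod]].
  assert (Hser := is_series_Re _ _ (Hy (k + 2)%nat ltac:(lia))).
  rewrite <- (is_series_unique _ _ Hser).
  assert (Hre : forall j, Re (Cmult (mult_hankel alpha (k + 2) (j + 2))
      (test_vector (b / 2) r N (j + 2))) =
      Re (alpha ((k + 2) * (j + 2))%nat) * Re (test_vector (b / 2) r N (j + 2))).
  { intros j; unfold mult_hankel, test_vector.
    destruct (j + 2 <=? N + 2)%nat; unfold Cmult, Re, RtoC; simpl; ring. }
  assert (Hal : forall j, 0 < Re (alpha ((k + 2) * (j + 2))%nat)).
  { intros j; eapply Rlt_le_trans; [|apply Ha; lia].
    pose proof (INR_add2_ge j); pose proof (ln_add2_pos j).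
    rewrite ln_mul_add2, sqrt_mul_add2.
    apply Rdiv_lt_0_compat; [exact Hc|].
    repeat apply Rmult_lt_0_compat; try lra; apply sqrt_lt_R0; lra. }
  assert (Hx : forall j, 0 <= Re (test_vector (b / 2) r N (j + 2))).
  { intros j; destruct (Nat.le_gt_cases j N) as [H|H].
    - rewrite test_vector_in by exact H; simpl.
      pose proof (INR_add2_ge j); pose proof (ln_add2_pos j).
      apply Rdiv_le_0_compat; [exact Hr|].
      apply Rmult_lt_0_compat; apply sqrt_lt_R0; lra.
    - rewrite test_vector_out by exact H; simpl; lra. }
  eapply Rle_trans; [|apply (sum_n_le_Series _ N)].
  2: { intros j; rewrite Hre; apply Rmult_le_pos; [left; apply Hal|apply Hx]. }
  2: { eexists; exact Hser. }
  apply Rle_trans with (sum_n (fun j => c * r / sqrt (INR (k + 2)) *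
      hilbert_summand (b / 2) L (INR (j + 2))) N).
  - rewrite sum_n_Rmult_l.
    apply Rle_trans with (c * r / sqrt (INR (k + 2)) * ((PI - 4 / s) / sqrt L));
      [right; field; lra|].
    apply Rmult_le_compat_l.
    + apply Rdiv_le_0_compat; [apply Rmult_le_pos; lra|exact Sk].
    + eapply Rle_trans; [apply (hilbert_primitive_gap (b / 2) L s (INR (N + 3)));
        [lra|exact HL|exact Hs|exact Hlo|exact Hhi]|].
      replace (N + 3)%nat with (S N + 2)%nat by lia.
      replace 2 with (INR (0 + 2)) at 2 by (simpl; ring).
      apply (sum_n_ge_telescope _
        (fun j => hilbert_primitive (b / 2) L (INR (j + 2)))).
      intros j; replace (S j + 2)%nat with (S (j + 2)) by lia; rewrite S_INR.
      pose proof (INR_add2_ge j); apply hilbert_primitive_le_summand; lra.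
  - apply sum_n_le_ext; intros j Hj.
    rewrite Hre, test_vector_in by exact Hj; unfold hilbert_summand; simpl Re.
    pose proof (INR_add2_ge j) as Hj2; pose proof (ln_add2_pos j) as Lj.
    assert (Sj : 0 < sqrt (INR (j + 2))) by (apply sqrt_lt_R0; lra).
    assert (SLj : 0 < sqrt (ln (INR (j + 2)) + b / 2)) by (apply sqrt_lt_R0; lra).
    eapply Rle_trans; [|apply Rmult_le_compat_r;
      [apply Rdiv_le_0_compat; [exact Hr|apply Rmult_lt_0_compat; lra]|apply Ha; lia]].
    rewrite ln_mul_add2, sqrt_mul_add2; right.
    assert (Ej := sqrt_sqrt (INR (j + 2)) ltac:(lra)).
    set (q := sqrt (INR (j + 2))) in *; set (l := ln (INR (j + 2))) in *.
    rewrite <- Ej; unfold L; field; repeat split; lra.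
Qed.

Lemma log_sum_pos (beta : R) (N : nat) : 0 <= beta -> 0 < log_sum beta N.
Proof.
  intros Hb; assert (Hp : forall k, 0 < / (INR (k + 2) * (ln (INR (k + 2)) + beta))).
  { intros k; pose proof (INR_add2_ge k); pose proof (ln_add2_pos k).
    apply Rinv_0_lt_compat, Rmult_lt_0_compat; lra. }
  eapply Rlt_le_trans; [apply (Hp 0%nat)|].
  rewrite <- (sum_O (fun k => / (INR (k + 2) * (ln (INR (k + 2)) + beta)))).
  apply sum_n_mono; [intros k; left; apply Hp|lia].
Qed.

(** Only the middle range [k0 < k <= k1] is kept on the side of the image, where
    it compares entrywise with the test vector; the norm of the latter still
    runs over all indices up to [N]. *)
Lemma hankel_lower_bound_finite (alpha : nat -> C) (b c M s : R) (k0 k1 N : nat) :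
  0 <= b -> 0 < c -> 2 <= s ->
  (forall n, (2 <= n)%nat -> c / (sqrt (INR n) * (b + ln (INR n))) <= Re (alpha n)) ->
  (forall x, in_l2 x -> l2_norm x <= 1 ->
     exists y, mat_maps (mult_hankel alpha) x y /\ in_l2 y /\ l2_norm y <= M) ->
  (k0 <= k1)%nat ->
  s ^ 2 * (ln 2 + b / 2) <= ln (INR (k0 + 2)) + b / 2 ->
  s ^ 2 * (ln (INR (k1 + 2)) + b / 2) <= ln (INR (N + 3)) + b / 2 ->
  (c * (PI - 4 / s)) ^ 2 * (log_sum (b / 2) k1 - log_sum (b / 2) k0) <=
  M ^ 2 * log_sum (b / 2) N.
Proof.
  intros Hb Hc Hs Ha HM Hk Hlo Hhi.
  assert (Hb2 : 0 <= b / 2) by lra.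
  pose proof (log_sum_pos (b / 2) N Hb2) as HH.
  set (H := log_sum (b / 2) N) in *.
  set (r := / sqrt H).
  pose proof (sqrt_lt_R0 _ HH) as SH.
  assert (Hr : 0 < r) by (apply Rinv_0_lt_compat, SH).
  assert (Hr2 : r ^ 2 * H = 1).
  { unfold r; rewrite pow_inv, pow2_sqrt by lra; field; lra. }
  pose proof (test_vector_sq_norm (b / 2) r N Hb2) as Hx; fold H in Hx; rewrite Hr2 in Hx.
  destruct (HM (test_vector (b / 2) r N)) as [y [Hy [Hy2 Hyn]]].
  - eexists; exact Hx.
  - unfold l2_norm; rewrite (is_series_unique _ _ Hx), sqrt_1; lra.
  - set (v := fun k => Cmod (y (k + 2)%nat) ^ 2).
    assert (Hv : forall k, 0 <= v k) by (intros; apply pow2_ge_0).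
    assert (Hsum : sum_n v k1 <= M ^ 2).
    { eapply Rle_trans; [apply sum_n_le_Series; [exact Hv|exact Hy2]|].
      assert (H0 : 0 <= Series v).
      { eapply Rle_trans; [apply (sum_n_nonneg v 0 Hv)|].
        apply sum_n_le_Series; [exact Hv|exact Hy2]. }
      rewrite <- (pow2_sqrt _ H0); apply pow_incr; split; [apply sqrt_pos|exact Hyn]. }
    assert (Hphi : 0 <= PI - 4 / s).
    { pose proof PI2_3_2. assert (4 / s <= 2) by (apply Rle_div_l; lra). lra. }
    assert (Hinc : (c * r * (PI - 4 / s)) ^ 2 *
        (log_sum (b / 2) k1 - log_sum (b / 2) k0) <= sum_n v k1 - sum_n v k0).
    { unfold log_sum; rewrite Rmult_minus_distr_l, <- !sum_n_Rmult_l.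
      apply sum_n_increment_le; [exact Hk|]; intros k Hkk.
      pose proof (INR_add2_ge k) as Hk2; pose proof (ln_add2_pos k) as Lk.
      assert (Sk : 0 < sqrt (INR (k + 2))) by (apply sqrt_lt_R0; lra).
      assert (SL : 0 < sqrt (ln (INR (k + 2)) + b / 2)) by (apply sqrt_lt_R0; lra).
      assert (Hmono : forall i j, (i <= j)%nat -> ln (INR (i + 2)) <= ln (INR (j + 2))).
      { intros i j Hij; apply ln_le; [pose proof (INR_add2_ge i); lra|].
        apply le_INR; lia. }
      apply Rle_trans with ((c * r * (PI - 4 / s) /
        (sqrt (INR (k + 2)) * sqrt (ln (INR (k + 2)) + b / 2))) ^ 2).
      - set (A := c * r * (PI - 4 / s)); set (L := ln (INR (k + 2)) + b / 2) in *.
        assert (0 < L) by (unfold L; lra).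
        unfold Rdiv; rewrite Rpow_mult_distr, pow_inv, Rpow_mult_distr, !pow2_sqrt by lra.
        apply Rle_refl.
      - apply pow_incr; split.
        + apply Rdiv_le_0_compat; [|apply Rmult_lt_0_compat; lra].
          repeat apply Rmult_le_pos; lra.
        + apply (hankel_test_vector_ge alpha b c r s N k y); try assumption; try lra.
          * specialize (Hmono k0 k ltac:(lia)); lra.
          * specialize (Hmono k k1 ltac:(lia)).
            assert (s ^ 2 * (ln (INR (k + 2)) + b / 2) <=
                    s ^ 2 * (ln (INR (k1 + 2)) + b / 2))
              by (apply Rmult_le_compat_l; [apply pow2_ge_0|lra]).
            lra. }
    pose proof (sum_n_nonneg v k0 Hv).
    replace ((c * r * (PI - 4 / s)) ^ 2) with ((c * (PI - 4 / s)) ^ 2 * r ^ 2) in Hinc by ring.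
    apply Rmult_le_reg_l with (r ^ 2); [apply pow_lt, Hr|].
    replace (r ^ 2 * (M ^ 2 * H)) with (M ^ 2 * (r ^ 2 * H)) by ring.
    rewrite Hr2; nra.
Qed.

(** [log_sum] behaves as an iterated logarithm, so that passing from
    [k + 2] to its [p]-th power adds only a bounded amount. *)
Lemma log_sum_pow_le (beta : R) (k p : nat) :
  0 <= beta -> (1 <= p)%nat ->
  log_sum beta ((k + 2) ^ p - 2) - log_sum beta k <= ln (INR p).
Proof.
  intros Hb Hp.
  assert (Hk : (k + 2 <= (k + 2) ^ p)%nat).
  { rewrite <- (Nat.pow_1_r (k + 2)) at 1; apply Nat.pow_le_mono_r; lia. }
  eapply Rle_trans; [apply log_sum_increment_le; [exact Hb|lia]|].
  replace ((k + 2) ^ p - 2 + 2)%nat with ((k + 2) ^ p)%nat by lia.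
  pose proof (INR_add2_ge k); pose proof (ln_add2_pos k).
  rewrite pow_INR, ln_pow by lra.
  assert (Hp1 : 1 <= INR p) by (apply (le_INR 1); exact Hp).
  assert (Hln : ln (INR p * ln (INR (k + 2)) + beta) <= ln (INR p * (ln (INR (k + 2)) + beta))).
  { apply ln_le; nra. }
  rewrite ln_mult in Hln by lra; lra.
Qed.

(** For fixed [s] the middle range can be chosen to reach [k1] when the
    truncation is at [(k1 + 2) ^ (2 s^2)]. The squared norms over the middle range
    and over the whole range then differ by a quantity bounded independently of [k1],
    whereas both diverge with [k1]; hence [c * (PI - 4 / s) <= M], and [s] is
    arbitrary. *)
Lemma hankel_lower_bound (alpha : nat -> C) (b c M : R) :
  0 <= b -> 0 < c ->
  (forall n, (2 <= n)%nat -> c / (sqrt (INR n) * (b + ln (INR n))) <= Re (alpha n)) ->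
  (forall x, in_l2 x -> l2_norm x <= 1 ->
     exists y, mat_maps (mult_hankel alpha) x y /\ in_l2 y /\ l2_norm y <= M) ->
  c * PI <= M.
Proof.
  intros Hb Hc Ha HM.
  assert (HM0 : 0 <= M).
  { (* With [r = 0] the test vector is the zero vector. *)
    destruct (HM (test_vector 0 0 0)) as [y [_ [_ Hy]]].
    - eexists; apply (test_vector_sq_norm 0 0 0 (Rle_refl 0)).
    - unfold l2_norm; rewrite (is_series_unique _ _ (test_vector_sq_norm 0 0 0 (Rle_refl 0))).
      replace (0 ^ 2 * log_sum 0 0) with 0 by ring; rewrite sqrt_0; lra.
    - eapply Rle_trans; [apply sqrt_pos|exact Hy]. }
  assert (Hs : forall s : nat, (2 <= s)%nat -> c * (PI - 4 / INR s) <= M).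
  { intros s Hs; apply Rnot_lt_le; intros Hlt.
    assert (Hs2 : 2 <= INR s) by (apply (le_INR 2); exact Hs).
    set (A := (c * (PI - 4 / INR s)) ^ 2).
    assert (HA : M ^ 2 < A) by (unfold A; set (X := c * (PI - 4 / INR s)) in *; nra).
    (* The factor 2 absorbs the shift: [ln (k1 + 2) + b / 2 <= 2 * ln (k1 + 2)]
       once [k1] is large. *)
    set (p := (2 * s ^ 2)%nat).
    assert (Hp : (1 <= p)%nat) by (unfold p; simpl; nia).
    assert (Hp' : INR p = 2 * INR s ^ 2)
      by (unfold p; rewrite mult_INR, pow_INR; reflexivity).
    pose proof is_lim_seq_ln_add2 as Hln.
    apply is_lim_seq_spec in Hln.
    destruct (Hln (INR s ^ 2 * (ln 2 + b / 2))) as [k0 Hk0].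
    assert (Hb2 : 0 <= b / 2) by lra.
    pose proof (is_lim_seq_log_sum (b / 2) Hb2) as HH.
    apply is_lim_seq_spec in HH.
    (* Beyond this threshold the finite inequality fails if [M ^ 2 < A]. *)
    destruct (HH ((M ^ 2 * ln (INR p) + A * log_sum (b / 2) k0) / (A - M ^ 2))) as [K HK].
    destruct (Hln (b / 2)) as [K' HK'].
    set (k1 := (k0 + K + K')%nat).
    specialize (Hk0 k0 ltac:(lia)).
    specialize (HK k1 ltac:(unfold k1; lia)); specialize (HK' k1 ltac:(unfold k1; lia)).
    assert (Hpow : (k1 + 2 <= (k1 + 2) ^ p)%nat).
    { rewrite <- (Nat.pow_1_r (k1 + 2)) at 1; apply Nat.pow_le_mono_r; lia. }
    pose proof (INR_add2_ge k1) as Hk1; pose proof (ln_add2_pos k1) as Lk1.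
    assert (Hfin := hankel_lower_bound_finite alpha b c M (INR s) k0 k1
      ((k1 + 2) ^ p - 2) Hb Hc Hs2 Ha HM ltac:(unfold k1; lia) ltac:(lra)).
    fold A in Hfin.
    assert (Hfin' : A * (log_sum (b / 2) k1 - log_sum (b / 2) k0) <=
      M ^ 2 * log_sum (b / 2) ((k1 + 2) ^ p - 2)).
    { apply Hfin.
      apply Rle_trans with (INR p * ln (INR (k1 + 2))).
      - rewrite Hp'; assert (0 < INR s ^ 2) by (apply pow_lt; lra); nra.
      - rewrite <- ln_pow, <- pow_INR by lra.
        assert (ln (INR ((k1 + 2) ^ p)) <= ln (INR ((k1 + 2) ^ p - 2 + 3))).
        { apply ln_le; [apply (lt_INR 0); lia|apply le_INR; lia]. }
        lra. }
    pose proof (log_sum_pow_le (b / 2) k1 p Hb2 Hp) as Hinc.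
    apply Rlt_div_l in HK; [|lra].
    assert (M ^ 2 * log_sum (b / 2) ((k1 + 2) ^ p - 2) <=
      M ^ 2 * (log_sum (b / 2) k1 + ln (INR p)))
      by (apply Rmult_le_compat_l; [apply pow2_ge_0|lra]).
    nra. }
  apply Rnot_lt_le; intros Hlt.
  set (e := c * PI - M).
  assert (He : 0 < e) by (unfold e; lra).
  destruct (nfloor_ex (4 * c / e)) as [n [_ Hn]];
    [apply Rdiv_le_0_compat; lra|].
  specialize (Hs (n + 2)%nat ltac:(lia)).
  pose proof (INR_add2_ge n) as Hn2.
  assert (Hn' : 4 * c / e < INR (n + 2)) by (rewrite plus_INR; simpl; lra).
  apply Rlt_div_l in Hn'; [|exact He].
  assert (c * (4 / INR (n + 2)) < e).
  { replace (c * (4 / INR (n + 2))) with (4 * c / INR (n + 2)) by (field; lra).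
    apply Rlt_div_l; [lra|]. lra. }
  unfold e in *; lra.
Qed.

Lemma hankel_upper_bound (alpha : nat -> C) (D : R) :
  0 < D ->
  (forall n, (2 <= n)%nat -> Cmod (alpha n) <= D / (sqrt (INR n) * ln (INR n))) ->
  bounded_on_l2 (mult_hankel alpha) /\
  Rbar_le (op_norm (mult_hankel alpha)) (Finite (D * PI)).
Proof.
  intros HD Ha; pose proof (hankel_schur alpha D HD Ha) as HS; split.
  - exists (D * PI); intros x Hx.
    destruct (HS x Hx) as [[y Hy] Hb]; exists y; split; [exact Hy|exact (Hb y Hy)].
  - apply (proj2 (Lub_Rbar_correct _)); intros r [x [y [Hx [Hn [Hy [_ ->]]]]]].
    destruct (HS x Hx) as [_ Hb]; simpl.
    apply Rle_trans with (D * PI * l2_norm x); [exact (proj2 (Hb y Hy))|].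
    rewrite <- (Rmult_1_r (D * PI)) at 2; apply Rmult_le_compat_l; [|exact Hn].
    pose proof PI_RGT_0; nra.
Qed.

Theorem theorem2p1 :
  forall alpha : nat -> C,
    (forall D : R, 0 < D ->
       (forall n : nat, (2 <= n)%nat ->
          Cmod (alpha n) <= D / (sqrt (INR n) * ln (INR n))) ->
       bounded_on_l2 (mult_hankel alpha) /\
       Rbar_le (op_norm (mult_hankel alpha)) (Finite (D * PI)))
    /\
    (forall D b c : R, 0 < D -> 0 <= b -> 0 < c ->
       (forall n : nat, (2 <= n)%nat ->
          Cmod (alpha n) <= D / (sqrt (INR n) * ln (INR n))) ->
       (forall n : nat, (2 <= n)%nat ->
          Im (alpha n) = 0 /\ 0 < Re (alpha n)) ->
       (forall n : nat, (2 <= n)%nat ->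
          c / (sqrt (INR n) * (b + ln (INR n))) <= Re (alpha n)) ->
       bounded_on_l2 (mult_hankel alpha) /\
       Rbar_le (Finite (c * PI)) (op_norm (mult_hankel alpha)) /\
       Rbar_le (op_norm (mult_hankel alpha)) (Finite (D * PI))).
Proof.
  intros alpha; split; [apply hankel_upper_bound|].
  intros D b c HD Hb Hc Ha _ Hlow.
  destruct (hankel_upper_bound alpha D HD Ha) as [Hbd Hup].
  split; [exact Hbd|split; [|exact Hup]].
  assert (Hall : forall M : R, Rbar_le (op_norm (mult_hankel alpha)) M -> c * PI <= M).
  { intros M HM; apply (hankel_lower_bound alpha b c M Hb Hc Hlow).
    intros x Hx Hn; destruct Hbd as [B HB]; destruct (HB x Hx) as [y [Hy [Hy2 _]]].
    exists y; split; [exact Hy|split; [exact Hy2|]].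
    apply (Rbar_le_trans (Finite (l2_norm y)) (op_norm (mult_hankel alpha)) M); [|exact HM].
    apply (proj1 (Lub_Rbar_correct _)); exists x, y; auto. }
  destruct (op_norm (mult_hankel alpha)) as [M| |].
  - apply Hall, Rbar_le_refl.
  - exact I.
  - (* The value minus infinity would give [c * PI <= 0]. *)
    pose proof (Hall 0 I); pose proof PI_RGT_0; nra.
Qed.
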